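(* Let $q\equiv 3\pmod 4$ be a prime power and let $A$ be a multiplicative subgroup of $\mathbb{F}_q^*$ with $|A|\ge q^{2/3}$. For any $0<\delta\le 1$ there exists an integer $q_0=q_0(\delta)$ with the following property: if $q\ge q_0$, then any set $S\subset\mathbb{F}_q^2$ with $|S|\ge\delta q^2$ contains at least $c\,\frac{|S|^4|A|^2}{q^5}$ rectangles with side-lengths in $A$, where $c>0$ is an absolute constant.
   Context: For $u,v\in\mathbb{F}_q^2$, $u\cdot v=u_1v_1+u_2v_2$. Four points $x,z,y,t\in\mathbb{F}_q^2$ form a rectangle with vertices in the cyclic order $x,z,y,t$ if $(x-z)\cdot(y-z)=0$, $(z-y)\cdot(t-y)=0$, $(y-t)\cdot(x-t)=0$ and $(t-x)\cdot(z-x)=0$; the length of a side $uv$ is $(u-v)\cdot(u-v)$. Rectangles are counted as ordered quadruples of vertices. *)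

(* Defs.v *)
From HB Require Import structures.
From mathcomp Require Import all_boot all_order all_algebra all_fingroup all_field.
From mathcomp Require Import Rstruct.
Set Implicit Arguments. Unset Strict Implicit. Unset Printing Implicit Defensive.
Import Order.TTheory GRing.Theory Num.Theory.
Local Open Scope ring_scope.

Section Rect.
Variable F : finFieldType.

Definition dot (u v : F * F) : F := u.1 * v.1 + u.2 * v.2.
Definition sub2 (u v : F * F) : F * F := (u.1 - v.1, u.2 - v.2).
Definition len (u v : F * F) : F := dot (sub2 u v) (sub2 u v).

Definition is_rect (x z y t : F * F) : bool :=
  [&& dot (sub2 x z) (sub2 y z) == 0,
      dot (sub2 z y) (sub2 t y) == 0,
      dot (sub2 y t) (sub2 x t) == 0 &
      dot (sub2 t x) (sub2 z x) == 0].

Definition inA (A : {set {unit F}}) (a : F) : bool := [exists u in A, val u == a].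

Definition rects (A : {set {unit F}}) (S : {set F * F}) :
  {set (F * F) * (F * F) * (F * F) * (F * F)} :=
  [set w | let: (x, z, y, t) := w in
     [&& x \in S, z \in S, y \in S, t \in S, is_rect x z y t,
         inA A (len x z), inA A (len z y), inA A (len y t) & inA A (len t x)]].
End Rect.

(* Main.v *)
(** Fix a unit vector e and write the plane in the coordinates along e and its
    rotation by a right angle; since a in A gives a ^ 2 in A, it suffices to find
    many axis-parallel rectangles in a subset G of F x F whose side parameters lie
    in A.  Because A is stable under multiplication by its elements, x - y in A can
    be rewritten, for each d in A, as an incidence of the point (x, d') with the
    line {x = y + d d'}; a second moment estimate for point-line incidences then
    shows that every X in F has at least |A||X|^2/q - sqrt q |X| pairs differing by
    an element of A.  Applied to the rows of G this gives many horizontal sides,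
    and applied to the set of ordinates of the sides with fixed horizontal
    projection it gives, with Cauchy-Schwarz, at least |A|^2 |G|^4 / (8 q^6)
    rectangles, as soon as |A| exceeds sqrt q by a large factor.  Finally sum over
    the q unit vectors obtained by the rational parametrization of the circle; each
    rectangle arises at most twice, from e and - e.  The hypothesis q = 3 mod 4
    makes the parametrization total, as 1 + m ^ 2 never vanishes. *)
Require Import Defs.
From HB Require Import structures.
From mathcomp Require Import all_boot all_order all_algebra all_fingroup all_field.
From mathcomp Require Import Rstruct.
From mathcomp Require Import cyclic ring lra.
Import Order.TTheory GRing.Theory Num.Theory.
Local Open Scope ring_scope.

(** Cauchy-Schwarz, read off from the nonnegative sum of [(n * f i - s) ^+ 2], which equals
    [n * (n * T - s ^+ 2)]. *)
Lemma sqr_sum_le (R : realFieldType) (I : finType) (P : {pred I}) (f : I -> R) :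
  (\sum_(i in P) f i) ^+ 2 <= #|P|%:R * \sum_(i in P) f i ^+ 2.
Proof.
set s := \sum_(i in P) f i; set n : R := #|P|%:R; set T := \sum_(i in P) _.
have n_ge0 : 0 <= n by rewrite ler0n.
have : 0 <= \sum_(i in P) (n * f i - s) ^+ 2.
  by apply: sumr_ge0 => i _; exact: sqr_ge0.
have -> : \sum_(i in P) (n * f i - s) ^+ 2 = n * (n * T - s ^+ 2).
  have sqE i : (n * f i - s) ^+ 2 =
    n ^+ 2 * f i ^+ 2 + (- (2 * n * s)) * f i + s ^+ 2 by ring.
  under eq_bigr => i _ do rewrite sqE.
  rewrite !big_split /= -!mulr_sumr sumr_const -/s -/T -mulr_natl -/n; ring.
have [n0|] := ltrP 0 n; first by rewrite pmulr_rge0 // subr_ge0.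
move=> n_le0 _; have /eqP : n = 0 by apply/eqP; rewrite eq_le n_le0.
rewrite pnatr_eq0 => /eqP /card0_eq P0; rewrite /s big_pred0 // expr0n.
by rewrite mulr_ge0 // sumr_ge0 // => i _; exact: sqr_ge0.
Qed.

(** * Point-line incidences *)

Section Incidence.
Variables (R : realFieldType) (F : finFieldType).
Implicit Types (P G : {set F * F}) (X D : {set F}).
Notation q := (#|F|%:R : R).

Definition incid P (y d : F) : R := \sum_(p in P) (p.1 == y + d * p.2)%:R.

Lemma sum_pick (T : finType) (a : T) (g : T -> R) :
  \sum_x (x == a)%:R * g x = g a.
Proof.
rewrite (bigD1 a) //= eqxx mul1r big1 ?addr0 // => x /negbTE ->.
by rewrite mul0r.
Qed.

Lemma sum_pick1 (T : finType) (a : T) : \sum_x (x == a)%:R = 1 :> R.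
Proof.
rewrite -[RHS](sum_pick _ a (fun=> 1)).
by under [RHS]eq_bigr do rewrite mulr1.
Qed.

Lemma card_field_gt0 : 0 < q.
Proof. by rewrite ltr0n; apply/card_gt0P; exists 0. Qed.

(** The mean of [incid] over the [q ^+ 2] lines is [n / q]. The second moment is at most
    [q * n + n ^+ 2], and centring removes exactly [n ^+ 2]. *)
Lemma incid_variance P :
  \sum_y \sum_d (incid P y d - #|P|%:R / q) ^+ 2 <= q * #|P|%:R.
Proof.
have q0 := card_field_gt0; have qn0 : q != 0 by rewrite gt_eqF.
set n : R := #|P|%:R.
have eqy (x y d c : F) : (x == y + d * c) = (y == x - d * c).
  by rewrite [RHS]eq_sym subr_eq.
have sum1 : \sum_y \sum_d incid P y d = q * n.
  rewrite exchange_big /= (eq_bigr (fun=> n)) => [|d _].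
    by rewrite sumr_const mulr_natl.
  rewrite exchange_big /= (eq_bigr (fun=> 1)) => [|p _].
    by rewrite sumr_const.
  by under eq_bigr => y _ do rewrite eqy; exact: sum_pick1.
have sum2 : \sum_y \sum_d incid P y d ^+ 2 <= q * n + n ^+ 2.
  (* distinct points lie on at most one line x = y + d * u, a single point on q *)
  have -> : \sum_y \sum_d incid P y d ^+ 2 =
      \sum_(p in P) \sum_(p' in P) \sum_d (p.1 - p'.1 == d * (p.2 - p'.2))%:R.
    (* Expand the square: given [d] and [p], only [y = p.1 - d * p.2] contributes. *)
    rewrite exchange_big /=.
    under eq_bigr => d _ do under eq_bigr => y _ do
      rewrite expr2 /incid mulr_suml.
    under eq_bigr => d _ do rewrite exchange_big /=.
    rewrite exchange_big /=; apply: eq_bigr => p _.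
    rewrite [RHS]exchange_big /=; apply: eq_bigr => d _.
    under eq_bigr => y _ do rewrite eqy.
    rewrite (sum_pick _ _ (fun y => \sum_(p0 in P) (p0.1 == y + d * p0.2)%:R)).
    apply: eq_bigr => p' _; congr (_%:R); congr nat_of_bool.
    by rewrite -subr_eq0 -[RHS]subr_eq0 -[RHS]oppr_eq0; congr (_ == 0); ring.
  have -> : q * n + n ^+ 2 = \sum_(p in P) \sum_(p' in P) ((p' == p)%:R * q + 1).
    have qP p : p \in P -> \sum_(p' in P) ((p' == p)%:R * q + 1) = q + n.
      move=> pP; rewrite big_split /= sumr_const -/n; congr (_ + _).
      rewrite (bigD1 p) //= eqxx mul1r big1 ?addr0 // => p' /andP[_ /negbTE ->].
      by rewrite mul0r.
    by rewrite (eq_bigr _ qP) sumr_const -mulr_natl -/n; ring.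
  apply: ler_sum => p _; apply: ler_sum => p' _.
  have [->|npp'] := eqVneq p' p.
    rewrite mul1r; apply: le_trans (_ : \sum_(d : F) 1 <= _).
      by apply: ler_sum => d _; rewrite lern1 leq_b1.
    by rewrite sumr_const lerDl ler01.
  rewrite mul0r add0r; have [e2|ne2] := eqVneq p.2 p'.2.
    rewrite big1 ?ler01 // => d _; rewrite e2 subrr mulr0 subr_eq0.
    case: eqP => // e1; case/eqP: npp'.
    by rewrite [p]surjective_pairing e1 e2 -surjective_pairing.
  have n0 : p.2 - p'.2 != 0 by rewrite subr_eq0.
  have eqd (d : F) : (p.1 - p'.1 == d * (p.2 - p'.2)) =
      (d == (p.1 - p'.1) / (p.2 - p'.2)).
    by rewrite eq_sym (can2_eq (mulfK n0) (divfK n0)).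
  by under eq_bigr => d _ do rewrite eqd; rewrite sum_pick1.
have -> : \sum_y \sum_d (incid P y d - n / q) ^+ 2 =
   \sum_y \sum_d incid P y d ^+ 2 + (- (2 * n / q)) * (\sum_y \sum_d incid P y d)
   + n ^+ 2.
  have -> : n ^+ 2 = \sum_(y : F) \sum_(d : F) (n / q) ^+ 2.
    by rewrite !sumr_const -mulrnA -[RHS]mulr_natl natrM; field.
  rewrite mulr_sumr -!big_split; apply: eq_bigr => y _ /=.
  rewrite mulr_sumr -!big_split; apply: eq_bigr => d _ /=; ring.
rewrite sum1 (_ : - (2 * n / q) * (q * n) = - (2 * n ^+ 2)); last by field.
lra.
Qed.

(** * Differences lying in a multiplicatively stable set *)

Definition edges D X : R := \sum_(y in X) \sum_(u in D) (y + u \in X)%:R.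

Lemma sum_mem (T : finType) (X : {pred T}) (a : T) :
  \sum_(x in X) (x == a)%:R = (a \in X)%:R :> R.
Proof.
rewrite big_mkcond /= -(sum_pick _ a (fun x => (x \in X)%:R)).
by apply: eq_bigr => x _; case: (x \in X); rewrite ?mulr1 ?mulr0.
Qed.

Lemma sum_setX (T1 T2 : finType) (A : {set T1}) (B : {set T2}) (f : T1 -> T2 -> R) :
  \sum_(p in setX A B) f p.1 p.2 = \sum_(x in A) \sum_(y in B) f x y.
Proof. by rewrite pair_big; apply: eq_bigl => -[x y]; rewrite in_setX. Qed.

Lemma oppr_le_of_sqr (u v : R) : 0 <= v -> u ^+ 2 <= v ^+ 2 -> - v <= u.
Proof.
move=> v0 uv; rewrite leNgt; apply/negP => u_lt.
have : 0 < (- u - v) * (- u + v) by apply: mulr_gt0; lra.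
rewrite (_ : _ * _ = u ^+ 2 - v ^+ 2); last by ring.
by lra.
Qed.

Section Stable.
(** [k] plays the square root of [q], which an arbitrary [realFieldType] may lack. *)
Variables (D : {set F}) (k : R).
Hypothesis D0 : 0 \notin D.
Hypothesis Dmul : forall d u, d \in D -> (d * u \in D) = (u \in D).
Hypothesis k_ge0 : 0 <= k.
Hypothesis k_sqr : k ^+ 2 = q.
Notation a := (#|D|%:R : R).

(** Multiplication by [d] permutes [D], so the count is the same for every slope [d] in [D]. *)
Lemma incid_setX X y d : d \in D ->
  incid (setX X D) y d = \sum_(u in D) (y + u \in X)%:R.
Proof.
move=> dD; have dn0 : d != 0 by apply: contraNneq D0 => <-.
rewrite /incid (sum_setX _ _ _ _ (fun x u => (x == y + d * u)%:R)).
rewrite exchange_big /= [RHS](reindex_inj (mulfI dn0)) /=.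
apply: eq_big => [u|u _]; first by rewrite Dmul.
exact: sum_mem.
Qed.

(** The product [P] of [X] and [D] serves both as point set and as set of lines [(y, d)]. Its
    incidences number [a * edges D X]. Cauchy-Schwarz over these [n * a] lines, with the variance
    bound, keeps the deviation from the mean within [a * k * n]; then divide by [a]. *)
Lemma edges_ge X : a * #|X|%:R ^+ 2 / q - k * #|X|%:R <= edges D X.
Proof.
have q0 := card_field_gt0; have qn0 : q != 0 by rewrite gt_eqF.
have [->|[d0 d0D]] := set_0Vmem D.
  rewrite cards0 !mul0r sub0r.
  apply: le_trans (_ : 0 <= _); last by do 2!apply: sumr_ge0 => ? _.
  by rewrite oppr_le0 mulr_ge0.
have a0 : 0 < a by rewrite ltr0n; apply/card_gt0P; exists d0.
set n : R := #|X|%:R; have n0 : 0 <= n by rewrite ler0n.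
set P := setX X D; have cP : #|P|%:R = n * a by rewrite cardsX natrM.
pose J (p : F * F) : R := incid P p.1 p.2 - #|P|%:R / q.
have sumJ : \sum_(p in P) J p = a * (edges D X - a * n ^+ 2 / q).
  rewrite (sum_setX _ _ _ _ (fun y d => incid P y d - #|P|%:R / q)).
  under eq_bigr => y _ do under eq_bigr => d dD do rewrite incid_setX //.
  rewrite exchange_big sumr_const /= -[LHS]mulr_natl big_split /= -/(edges D X).
  by rewrite sumr_const -[_ *+ #|X|]mulr_natl -/n cP; congr (_ * _); field.
have J2 : \sum_(p in P) J p ^+ 2 <= q * (n * a).
  rewrite -cP; apply: le_trans (incid_variance P).
  rewrite pair_big big_mkcond /=; apply: ler_sum => p _.
  by case: ifP => // _; exact: sqr_ge0.
have := le_trans (sqr_sum_le _ _ _ J) (ler_wpM2l (ler0n _ _) J2).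
rewrite sumJ cP -k_sqr.
have -> : n * a * (k ^+ 2 * (n * a)) = (a * (k * n)) ^+ 2 by ring.
move/oppr_le_of_sqr; rewrite !mulr_ge0 // => /(_ isT).
by rewrite -mulrN ler_pM2l // => ?; lra.
Qed.

(** * Axis-parallel rectangles *)

Definition double_row G (x s : F) : {set F} :=
  [set y | ((x, y) \in G) && ((x + s, y) \in G)].

(** Sum [edges_ge] over the rows [col y]; Cauchy-Schwarz over the [q] rows yields the second factor
    [1 / q]. *)
Lemma sum_card_double_row_ge G :
  a * #|G|%:R ^+ 2 / q ^+ 2 - k * #|G|%:R <=
  \sum_x \sum_(s in D) #|double_row G x s|%:R.
Proof.
have q0 := card_field_gt0; have qn0 : q != 0 by rewrite gt_eqF.
pose col y : {set F} := [set x | (x, y) \in G].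
have cG : #|G|%:R = \sum_y #|col y|%:R :> R.
  rewrite -[LHS]sumr_const big_mkcond /=.
  under [RHS]eq_bigr => y _ do rewrite -sumr_const big_mkcond /=.
  rewrite exchange_big pair_big /=; apply: eq_bigr => -[x y] _ /=.
  by rewrite inE.
have -> : \sum_x \sum_(s in D) #|double_row G x s|%:R = \sum_y edges D (col y).
  under eq_bigr => x _ do under eq_bigr => s _ do
    rewrite -sumr_const big_mkcond /=.
  under eq_bigr => x _ do rewrite exchange_big /=.
  rewrite exchange_big; apply: eq_bigr => y _ /=.
  rewrite /edges [RHS]big_mkcond; apply: eq_bigr => x _ /=.
  rewrite inE; case: ifP => xyG; last by rewrite big1 // => s _; rewrite inE xyG.
  by apply: eq_bigr => s _; rewrite !inE xyG /=; case: ifP.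
apply: le_trans (ler_sum _ (fun y _ => edges_ge (col y))).
rewrite big_split /= sumrN -mulr_sumr -cG lerD2r -mulr_suml -mulr_sumr.
have := sqr_sum_le _ _ predT (fun y => #|col y|%:R : R).
rewrite -cG => CS.
rewrite ler_pdivlMr // mulrAC ler_pdivrMr ?exprn_gt0 //.
rewrite expr2 !mulrA ler_pM2r //.
rewrite -mulrA -[leRHS]mulrA ler_wpM2l // [leRHS]mulrC.
exact: CS.
Qed.

Definition grid_rects G : R := \sum_x \sum_(s in D) edges D (double_row G x s).

Lemma grid_rects_ge G : 4 * k * q ^+ 4 <= a * #|G|%:R ^+ 2 ->
  a ^+ 2 * #|G|%:R ^+ 4 / (8 * q ^+ 6) <= grid_rects G.
Proof.
have q0 := card_field_gt0; have qn0 : q != 0 by rewrite gt_eqF.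
set N : R := #|G|%:R => aN.
have N0 : 0 <= N by rewrite ler0n.
have Nq : N <= q ^+ 2 by rewrite -natrX ler_nat (leq_trans (max_card _)) // card_prod.
have k0 : 0 < k by rewrite lt_neqAle eq_sym k_ge0 andbT -sqrf_eq0 k_sqr.
have a0 : 0 < a.
  rewrite lt_neqAle ler0n andbT; apply: contraTneq aN => <-.
  by rewrite mul0r -ltNge !mulr_gt0 // exprn_gt0.
have q20 : 0 < q ^+ 2 by rewrite exprn_gt0.
set W : R := \sum_x \sum_(s in D) #|double_row G x s|%:R.
have WT : a * N ^+ 2 / q ^+ 2 - k * N <= W := sum_card_double_row_ge G.
set b := a * N ^+ 2 / q ^+ 2 in WT.
have b4 : 4 * k * q ^+ 2 <= b.
  by rewrite ler_pdivlMr // (_ : 4 * k * q ^+ 2 * q ^+ 2 = 4 * k * q ^+ 4) //; ring.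
have kN : k * N <= k * q ^+ 2 by rewrite ler_pM2l.
have kq0 : 0 < k * q ^+ 2 by rewrite mulr_gt0.
have W2 : b / 2 <= W by lra.
have Wk : 2 * k * q ^+ 2 <= W by lra.
have sumT (f : F -> R) : \sum_(x in [set: F]) f x = \sum_x f x.
  by apply: eq_bigl => x; rewrite inE.
(* Sum [edges_ge] over the [q * a] pairs [(x, s)]; by Cauchy-Schwarz the main term is at least
   [a / q * (W ^+ 2 / (q * a))]. *)
have gridW : W ^+ 2 / q ^+ 2 - k * W <= grid_rects G.
  rewrite /grid_rects.
  apply: le_trans (_ : \sum_x \sum_(s in D)
     (a / q * #|double_row G x s|%:R ^+ 2 - k * #|double_row G x s|%:R) <= _).
    rewrite pair_big big_split sumrN -!mulr_sumr /=.
    rewrite -(pair_big xpredT (mem D) (fun x s => #|double_row G x s|%:R)) /=.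
    rewrite -/W lerD2r.
    have := sqr_sum_le _ _ (mem (setX setT D))
      (fun p => #|double_row G p.1 p.2|%:R : R).
    rewrite (sum_setX _ _ _ _ (fun x s => #|double_row G x s|%:R)).
    rewrite (sum_setX _ _ _ _ (fun x s => #|double_row G x s|%:R ^+ 2)).
    rewrite cardsX cardsT natrM.
    rewrite !sumT.
    rewrite -/W pair_big /= => CS.
    rewrite ler_pdivrMr //.
    by apply: le_trans CS _; rewrite le_eqVlt; apply/orP; left; apply/eqP; field.
  apply: ler_sum => x _; apply: ler_sum => s _.
  by rewrite mulrAC; exact: edges_ge.
apply: le_trans gridW.
have -> : a ^+ 2 * N ^+ 4 / (8 * q ^+ 6) = (b ^+ 2 / 8) / q ^+ 2.
  by rewrite /b; field.
have -> : W ^+ 2 / q ^+ 2 - k * W = (W * (W - k * q ^+ 2)) / q ^+ 2 by field.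
rewrite ler_pM2r ?invr_gt0 //.
(* As [W] is at least [2 * k * q ^+ 2], the second factor is at least [W / 2], hence [b / 4]; this
   is the source of the 8. *)
have : (b / 2) * (b / 2 / 2) <= W * (W - k * q ^+ 2) by apply: ler_pM; lra.
by rewrite (_ : _ * (_ / 2) = b ^+ 2 / 8) //; field.
Qed.

End Stable.
End Incidence.

(** * The unit circle and rotated frames *)

Section Rectangles.
Variable F : finFieldType.
Hypothesis F_mod4 : (#|F| %% 4 = 3)%N.
Implicit Types (A : {group {unit F}}) (S : {set F * F}).

(** The order of [F] vanishes in [F]; being odd, it would equal 1 if 2 were 0. *)
Lemma two_neq0 : 2 != 0 :> F.
Proof.
have : #|F|%:R = 0 :> F by rewrite -FinRing.zmodXgE -cardsT expg_cardG ?inE.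
rewrite (divn_eq #|F| 4) F_mod4 => cF; apply/negP => /eqP two0.
move: cF; rewrite natrD natrM (natrM _ 2 2) (natrD _ 2 1) two0 !mulr0 !add0r.
by move/eqP; rewrite oner_eq0.
Qed.

(** If [m ^+ 2 = -1], then [m ^+ #|F| = m ^+ 3 = - m], while [m ^+ #|F| = m] in a finite field; so
    [m = 0], which is absurd. *)
Lemma addr1_sqr_neq0 (m : F) : 1 + m ^+ 2 != 0.
Proof.
have n2 := two_neq0; apply/negP => /eqP m2.
have {}m2 : m ^+ 2 = -1 by apply/eqP; rewrite -subr_eq0 opprK addrC m2.
have mq : m ^+ #|F| = - m.
  by rewrite (divn_eq #|F| 4) F_mod4 exprD mulnC exprM (exprM m 2 2) m2 sqrrN
             !expr1n mul1r exprS m2 mulrN1.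
have m0 : m = 0.
  move: mq; rewrite expf_card => /eqP; rewrite -addr_eq0 -mulr2n -mulr_natl.
  by rewrite mulf_eq0 (negbTE n2) => /eqP.
by move/eqP: m2; rewrite m0 expr0n eq_sym oppr_eq0 oner_eq0.
Qed.

Definition circ (m : F) : F * F :=
  ((1 - m ^+ 2) / (1 + m ^+ 2), 2 * m / (1 + m ^+ 2)).

Lemma circ_norm m : (circ m).1 ^+ 2 + (circ m).2 ^+ 2 = 1.
Proof. by have := addr1_sqr_neq0 m => mn0; rewrite /circ /=; field. Qed.

(** [m] is the slope of the line joining [(-1, 0)] to [circ m]. *)
Lemma circ_inj : injective circ.
Proof.
have n2 := two_neq0; suff K m : (circ m).2 / (1 + (circ m).1) = m.
  by move=> m m' e; rewrite -(K m) e K.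
have mn0 := addr1_sqr_neq0 m.
have -> : 1 + (circ m).1 = 2 / (1 + m ^+ 2) by rewrite /circ /=; field.
by rewrite /circ /=; field; rewrite n2 mn0.
Qed.

(** Complex multiplication of [p] by [e]; for a unit [e] the inverse is multiplication by the
    conjugate. *)
Definition rot (e p : F * F) : F * F :=
  (p.1 * e.1 - p.2 * e.2, p.1 * e.2 + p.2 * e.1).

Lemma rot_inj e : e.1 ^+ 2 + e.2 ^+ 2 = 1 -> injective (rot e).
Proof.
move=> e1; apply: (can_inj (g := fun p => (p.1 * e.1 + p.2 * e.2, p.2 * e.1 - p.1 * e.2))).
case=> x y; rewrite /rot /=; congr (_, _).
  by rewrite -[RHS]mulr1 -e1; ring.
by rewrite -[RHS]mulr1 -e1; ring.
Qed.

(** * Counting rectangles through their frames *)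

Definition sides A : {set F} := [set val u | u in A].

Lemma inA_sides A a : inA A a = (a \in sides A).
Proof.
apply/existsP/imsetP => [[u /andP[uA /eqP <-]]|[u uA ->]]; exists u => //.
by rewrite uA eqxx.
Qed.

Lemma card_sides A : #|sides A| = #|A|.
Proof. exact/card_imset/val_inj. Qed.

Lemma sides_neq0 A : 0 \notin sides A.
Proof.
apply/imsetP => -[u _ u0]; have := valP u; rewrite -[\val u]/(val u) -u0.
by rewrite unitr0.
Qed.

Lemma sides_mul A d u : d \in sides A -> (d * u \in sides A) = (u \in sides A).
Proof.
case/imsetP=> x xA ->; apply/imsetP/imsetP => -[y yA].
  move=> xu; exists (x^-1 * y)%g; first by rewrite groupM ?groupV.
  by rewrite FinRing.val_unitM FinRing.val_unitV -xu mulKr // (valP x).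
by move=> ->; exists (x * y)%g; rewrite ?groupM // FinRing.val_unitM.
Qed.

(* The entry (m, x, s, y, u) stands for the rectangle with a side in direction
   [circ m], with lower corner (x, y) and side parameters s, u in the
   coordinates rotated by [circ m]. *)
Definition framed A S : {set F * F * F * F * F} :=
  [set w | let: (m, x, s, y, u) := w in
    [&& s \in sides A, u \in sides A,
        rot (circ m) (x, y) \in S, rot (circ m) (x + s, y) \in S,
        rot (circ m) (x, y + u) \in S & rot (circ m) (x + s, y + u) \in S]].

(* The side with direction [circ m] determines [m] and [s] up to
   (circ m, s) |-> (- circ m, - s); the boolean records which of [s], [- s] is used. *)
Definition framed_rect (w : F * F * F * F * F) :=
  let: (m, x, s, y, u) := w in
  (rot (circ m) (x, y), rot (circ m) (x + s, y),
   rot (circ m) (x + s, y + u), rot (circ m) (x, y + u),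
   (enum_rank s < enum_rank (- s))%N).

Lemma framed_rect_rects A S w :
  w \in framed A S -> (framed_rect w).1 \in rects A S.
Proof.
move: w => [[[[m x] s] y] u]; rewrite !inE /= => /and5P[sA uA -> -> /andP[-> ->]] /=.
have e1 := circ_norm m; case: (circ m) e1 => c d /= e1.
have len_s : len (rot (c, d) (x, y)) (rot (c, d) (x + s, y)) = s * s.
  by rewrite -[RHS]mulr1 -e1 /len /dot /sub2 /rot /=; ring.
have len_u : len (rot (c, d) (x + s, y)) (rot (c, d) (x + s, y + u)) = u * u.
  by rewrite -[RHS]mulr1 -e1 /len /dot /sub2 /rot /=; ring.
have len_s' : len (rot (c, d) (x + s, y + u)) (rot (c, d) (x, y + u)) = s * s.
  by rewrite -[RHS]mulr1 -e1 /len /dot /sub2 /rot /=; ring.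
have len_u' : len (rot (c, d) (x, y + u)) (rot (c, d) (x, y)) = u * u.
  by rewrite -[RHS]mulr1 -e1 /len /dot /sub2 /rot /=; ring.
rewrite !inA_sides len_s len_u len_s' len_u' !sides_mul // sA uA !andbT.
by rewrite /is_rect /dot /sub2 /rot /=; apply/and4P; split; apply/eqP; ring.
Qed.

(** The first side gives [s * e = s' * e'] with unit vectors [e] and [e'], so [s' = s] or
    [s' = - s]. Once the boolean has fixed the sign, cancelling [s] gives the direction, and the
    first and last vertices give [x], [y] and [u]. *)
Lemma framed_rect_inj A S : {in framed A S &, injective framed_rect}.
Proof.
move=> [[[[m x] s] y] u] [[[[m' x'] s'] y'] u'].
rewrite !inE /framed_rect => /andP[sA _] _.
have s0 : s != 0 by apply: contraNneq (sides_neq0 A) => <-.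
have := @circ_inj m m'; have := circ_norm m'; have := circ_norm m.
move: (circ m) (circ m') => [c d] [c' d'] /= e1 e1' cd_inj.
case=> p1 p2 z1 z2 _ _ t1 t2 b.
have E1 : s * c = s' * c'.
  have -> : s * c = (x + s) * c - y * d - (x * c - y * d) by ring.
  by rewrite z1 p1; ring.
have E2 : s * d = s' * d'.
  have -> : s * d = (x + s) * d + y * c - (x * d + y * c) by ring.
  by rewrite z2 p2; ring.
have ss : s ^+ 2 = s' ^+ 2.
  rewrite -[LHS]mulr1 -e1 -[RHS]mulr1 -e1' !mulrDr -!exprMn.
  by rewrite E1 E2.
have es : s' = s.
  move/eqP: ss; rewrite eqf_sqr => /orP[/eqP -> //|/eqP s_s'].
  (* If [s = - s'], then [b] says that the ranks of [s'] and [- s'] compare alike in both orders;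
     they coincide and [s' = - s']. *)
  by move: b; rewrite s_s' opprK; case: ltngtP => // /val_inj/enum_rank_inj.
subst s'; have ? := mulfI s0 E1; have ? := mulfI s0 E2; subst c' d'.
have /(_ erefl) ? := cd_inj; subst m'.
have [? ?] : (x, y) = (x', y').
  by apply: (rot_inj (c, d) e1); rewrite /rot /= p1 p2.
subst x' y'.
have [/addrI ->] // : (x, y + u) = (x, y + u').
by apply: (rot_inj (c, d) e1); rewrite /rot /= t1 t2.
Qed.

Lemma card_framed_le A S : (#|framed A S| <= 2 * #|rects A S|)%N.
Proof.
rewrite -(card_in_imset (@framed_rect_inj A S)) mulnC -card_bool -cardsT -cardsX.
apply/subset_leq_card/subsetP => _ /imsetP[w wQ ->].
have := framed_rect_rects _ _ _ wQ; case: (framed_rect w) => r b rA.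
by rewrite in_setX rA inE.
Qed.

Lemma sum_grid_rects (R : realFieldType) A S :
  \sum_m grid_rects R F (sides A) (rot (circ m) @^-1: S) = #|framed A S|%:R.
Proof.
rewrite -[RHS]sumr_const [RHS]big_mkcond /grid_rects /edges /=.
rewrite pair_big_dep pair_big_dep pair_big_dep pair_big_dep /=.
rewrite [LHS]big_mkcond.
apply: eq_bigr => -[[[[m x] s] y] u] _ /=.
rewrite !inE /= !andbA; do !case: (_ \in _) => //=.
Qed.

End Rectangles.

Theorem theorem3p1 :
  exists c : Rdefinitions.R, 0 < c /\
  forall delta : Rdefinitions.R, 0 < delta <= 1 ->
  exists q0 : nat,
  forall (F : finFieldType) (A : {group {unit F}}) (S : {set F * F}),
    (q0 <= #|F|)%N ->
    (#|F| %% 4 = 3)%N ->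
    (#|F| ^ 2 <= #|A| ^ 3)%N ->
    delta * (#|F|%:R) ^+ 2 <= (#|S|%:R : Rdefinitions.R) ->
    c * (#|S|%:R) ^+ 4 * (#|A|%:R) ^+ 2 / (#|F|%:R) ^+ 5
      <= (#|rects A S|%:R : Rdefinitions.R).
Proof.
(* 1/8 comes from [grid_rects_ge] and 1/2 from the double counting of frames. *)
exists (1 / 16); split=> [|delta /andP[d0 _]]; first by lra.
(* [K] is chosen so that [K * q <= a ^+ 2] gives [4 * k <= a * delta ^+ 2] after squaring. *)
have [K K0 Kd] : exists2 K, 0 < K & K * delta ^+ 4 = 16.
  exists (16 / delta ^+ 4); first by rewrite divr_gt0 ?exprn_gt0.
  by rewrite divfK // expf_neq0 // gt_eqF.
(* With [K ^+ 3 <= q], the size of [A] gives [(K * q) ^+ 3 <= q ^+ 4 <= a ^+ 6]. *)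
exists (Num.bound (K ^+ 3)) => F A S qK F4 qA SN.
pose q : Rdefinitions.R := #|F|%:R; pose a : Rdefinitions.R := #|A|%:R.
pose N : Rdefinitions.R := #|S|%:R; pose k := Num.sqrt q.
rewrite -/q -/a -/N; rewrite -/q -/N in SN.
have q0 : 0 < q := card_field_gt0 _ F.
have a0 : 0 <= a := ler0n _ _.
have k2 : k ^+ 2 = q by rewrite sqr_sqrtr // ltW.
have k0 : 0 <= k := sqrtr_ge0 _.
have {}qA : q ^+ 2 <= a ^+ 3 by rewrite -!natrX ler_nat.
have {}qK : K ^+ 3 <= q.
  apply/ltW/(lt_le_trans (archi_boundP _)); first by rewrite exprn_ge0 // ltW.
  by rewrite ler_nat.
have Kqa : K * q <= a ^+ 2.
  rewrite -(ler_pXn2r (ltn0Sn 2)) ?nnegrE ?exprn_ge0 ?mulr_ge0 ?(ltW K0) ?(ltW q0) //.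
  have -> : (a ^+ 2) ^+ 3 = (a ^+ 3) ^+ 2 by ring.
  apply: le_trans (_ : (q ^+ 2) ^+ 2 <= _).
    rewrite exprMn (_ : (q ^+ 2) ^+ 2 = q * q ^+ 3); last by ring.
    by rewrite ler_pM2r // exprn_gt0.
  by rewrite ler_pXn2r ?nnegrE ?exprn_ge0 ?(ltW q0).
have ka : 4 * k <= a * delta ^+ 2.
  rewrite -(ler_pXn2r (ltn0Sn 1)) ?nnegrE ?mulr_ge0 ?exprn_ge0 ?(ltW d0) //.
  have -> : (4 * k) ^+ 2 = 16 * q by rewrite exprMn k2; congr (_ * _); ring.
  have -> : (a * delta ^+ 2) ^+ 2 = a ^+ 2 * delta ^+ 4 by ring.
  rewrite -Kd mulrAC ler_pM2r ?exprn_gt0 //.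
have kN : 4 * k * q ^+ 4 <= a * N ^+ 2.
  apply: le_trans (_ : a * (delta * q ^+ 2) ^+ 2 <= _); last first.
    rewrite ler_wpM2l // ler_pXn2r ?nnegrE ?ler0n //.
    by rewrite mulr_ge0 ?exprn_ge0 ?ltW.
  rewrite (_ : a * _ = a * delta ^+ 2 * q ^+ 4); last by ring.
  by rewrite ler_pM2r // exprn_gt0.
have grid_ge m : a ^+ 2 * N ^+ 4 / (8 * q ^+ 6) <=
    grid_rects _ F (sides F A) (rot F (circ F m) @^-1: S).
  have cG : #|rot F (circ F m) @^-1: S| = #|S|.
    by apply: card_preimset; apply: rot_inj; exact: circ_norm.
  have := grid_rects_ge _ F (sides F A) k (sides_neq0 F A) (sides_mul F A) k0 k2.
  by move/(_ (rot F (circ F m) @^-1: S)); rewrite card_sides cG; exact.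
have : \sum_(m : F) a ^+ 2 * N ^+ 4 / (8 * q ^+ 6) <= #|framed F A S|%:R.
  by rewrite -sum_grid_rects; apply: ler_sum => m _; exact: grid_ge.
have : #|framed F A S|%:R <= (2 * #|rects A S|)%:R :> Rdefinitions.R.
  by rewrite ler_nat card_framed_le.
move=> /[swap] /le_trans/[apply]; rewrite sumr_const -[_ *+ #|_|]mulr_natl -/q.
(* The [q] directions turn [q ^+ 6] into [q ^+ 5]. *)
rewrite natrM (_ : q * _ = 2 * (1 / 16 * N ^+ 4 * a ^+ 2 / q ^+ 5)).
  by rewrite ler_pM2l.
by field; rewrite gt_eqF.
Qed.
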